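(* Let $\mathsf{T}$ be a centrally symmetric triangulation of the sphere $\mathcal{S}^{n-1}$ and let $\lambda_1,\ldots,\lambda_n$ be $n$ compatible Fan labelings of $\mathsf{T}$. Suppose the simplicial complex $\mathsf{T}/\mathbb{Z}_2$ is balanced. Then there are at least $n!$ pairs $(\sigma,\pi)$, where $\sigma$ is a simplex of $\mathsf{T}$ and $\pi\colon V(\sigma)\to[n]$ is a bijection, such that for some ordering $v_1,\ldots,v_n$ of the vertices of $\sigma$, $$0<-\lambda_{\pi(v_1)}(v_1)<\lambda_{\pi(v_2)}(v_2)<\cdots<(-1)^n\lambda_{\pi(v_n)}(v_n).$$
   Context: $\mathsf{T}$ is a free simplicial $\mathbb{Z}_2$-complex via the antipodal map. A Fan labeling of $\mathsf{T}$ is a labeling of its vertices by non-zero integers such that (i) no two adjacent vertices have labels summing to zero, and (ii) antipodal vertices have labels summing to zero. Fan labelings $\lambda_1,\ldots,\lambda_n$ are compatible if $\lambda_i(u)+\lambda_{i'}(u')\neq0$ for any two adjacent (distinct) vertices $u,u'$ and any $i,i'$. $\mathsf{T}/\mathbb{Z}_2$ is the triangulation of the $(n-1)$-dimensional projective space obtained by identifying antipodal simplices. A $d$-dimensional simplicial complex is balanced if its vertices can be colored with $d+1$ colors so that every $d$-dimensional simplex has vertices of pairwise distinct colors. *)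

(* Defs.v *)
From HB Require Import structures.
From mathcomp Require Import all_boot all_order all_algebra.
From mathcomp Require Import all_classical all_reals topology normedtype.
Import Order.TTheory GRing.Theory Num.Theory.
Import numFieldNormedType.Exports.
Local Open Scope ring_scope.

(* An abstract simplicial complex on the finite vertex set V is given by its
   set of faces F.  Its geometric realization |F| lives in the standard
   simplex of R^V, coordinates indexed through enum_rank. *)
Definition realization (R : realType) (V : finType) (F : {set {set V}}) :
  set 'rV[R]_#|V| :=
  fun x => (forall j, 0 <= x ord0 j) /\ \sum_j x ord0 j = 1 /\
    exists2 s, s \in F & forall j, x ord0 j != 0 -> enum_val j \in s.

(* the simplicial involution iota acting on points of the realization
   (it sends sum_v x_v e_v to sum_v x_v e_(iota v)) *)
Definition act_pt (R : realType) (V : finType) (iota : V -> V)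
  (x : 'rV[R]_#|V|) : 'rV[R]_#|V| :=
  \row_j x ord0 (enum_rank (iota (enum_val j))).

Definition unit_sphere (R : realType) (n : nat) : set 'rV[R]_n :=
  fun y => \sum_i y ord0 i ^+ 2 = 1.

Definition cs_sphere_triangulation (R : realType) (n : nat) (V : finType)
  (F : {set {set V}}) (iota : V -> V) : Prop :=
  (forall s t : {set V}, s \in F -> t \subset s -> t \in F) /\
  (forall v, [set v] \in F) /\
  involutive iota /\ (forall v, iota v != v) /\
  (forall s, s \in F -> iota @: s \in F) /\
  exists h : 'rV[R]_#|V| -> 'rV[R]_n, exists g : 'rV[R]_n -> 'rV[R]_#|V|,
    {within realization R V F, continuous h}%classic /\
    {within unit_sphere R n, continuous g}%classic /\
    (forall x, realization R V F x -> unit_sphere R n (h x) /\ g (h x) = x) /\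
    (forall y, unit_sphere R n y -> realization R V F (g y) /\ h (g y) = y) /\
    (forall x, realization R V F x -> h (act_pt R V iota x) = - h x).

Definition adjacent (V : finType) (F : {set {set V}}) (u u' : V) : Prop :=
  u != u' /\ [set u; u'] \in F.

Definition fan_labeling (V : finType) (F : {set {set V}}) (iota : V -> V)
  (lam : V -> int) : Prop :=
  (forall v, lam v != 0) /\
  (forall u u', adjacent V F u u' -> lam u + lam u' != 0) /\
  (forall v, lam v + lam (iota v) = 0).

Definition compatible (n : nat) (V : finType) (F : {set {set V}})
  (lam : 'I_n -> V -> int) : Prop :=
  forall i i' u u', adjacent V F u u' -> lam i u + lam i' u' != 0.

(* T/Z2 is balanced: its vertices (the iota-orbits) can be colored with
   n = d+1 colors so that each (n-1)-simplex (image of a facet of T, i.e. of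
   a face with n vertices) has pairwise distinct colors. *)
Definition balanced_quotient (n : nat) (V : finType) (F : {set {set V}})
  (iota : V -> V) : Prop :=
  exists c : V -> 'I_n, (forall v, c (iota v) = c v) /\
    forall s, s \in F -> #|s| = n -> {in s &, injective c}.

(* a bijection pi : V(s) -> [n] is encoded as f : {ffun V -> option 'I_n}
   with f x = Some (pi x) for x in s and f x = None outside s *)
Definition bij_onto (n : nat) (V : finType) (s : {set V})
  (f : {ffun V -> option 'I_n}) : bool :=
  [forall x, (f x == None) == (x \notin s)] &&
  [forall x in s, forall y in s, (f x == f y) ==> (x == y)] &&
  [forall j : 'I_n, exists x in s, f x == Some j].

Definition lab_at (n : nat) (V : finType) (lam : 'I_n -> V -> int)
  (f : {ffun V -> option 'I_n}) (x : V) : int :=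
  match f x with Some j => lam j x | None => 0 end.

(* (s, pi) is a good pair: s a simplex, pi a bijection, and some ordering
   o 0, ..., o (n-1) of the vertices of s satisfies
   0 < - lam_(pi v1)(v1) < lam_(pi v2)(v2) < ... < (-1)^n lam_(pi vn)(vn)
   (with v_(k+1) = o k). *)
Definition good_pair (n : nat) (V : finType) (F : {set {set V}})
  (lam : 'I_n -> V -> int) (s : {set V}) (f : {ffun V -> option 'I_n}) : bool :=
  (s \in F) && bij_onto n V s f &&
  [exists o : {ffun 'I_n -> V},
    [forall x, (x \in s) == [exists k, o k == x]] &&
    [forall k, forall k', (o k == o k') ==> (k == k')] &&
    [forall k : 'I_n, ((k : nat) == 0%N) ==>
        (0 < (-1) ^+ (k.+1) * lab_at n V lam f (o k))] &&
    [forall k : 'I_n, forall k' : 'I_n, ((k' : nat).+1 == k) ==>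
        ((-1) ^+ (k'.+1) * lab_at n V lam f (o k') <
         (-1) ^+ (k.+1) * lab_at n V lam f (o k))]].

(* Main.v *)
Require Import Defs.
From HB Require Import structures.
From mathcomp Require Import all_boot all_order all_algebra all_fingroup.
From mathcomp Require Import all_classical all_reals topology normedtype.
From mathcomp Require Import sequences realfun.
From mathcomp Require Import zify lra.
Import Order.TTheory GRing.Theory Num.Theory.
Import numFieldNormedType.Exports.

(* A permutation [p] of the colors turns the [n] labelings into the single Fan
   labeling [v |-> lam (p (col v)) v].  Fan's lemma gives it an alternating
   facet [s], and [p] is recovered from the pair [(s, p \o col)] because [col]
   is onto on [s]; hence [n!] pairs.

   Fan's lemma is proved mod 2 without assuming that the triangulation is
   compatible with a flag of hemispheres.  Barycentric subdivisions of the
   octahedral sphere give arbitrarily fine chains [c_0, c_1, ...] of point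
   tuples such that the boundary of [c_(k+1)] is [c_k] plus its antipode.  If
   tuples carry antipodal labels without opposite pairs, the number of faces of
   a tuple alternating with first sign [e] is congruent mod 2 to the number of
   signs with which the tuple itself alternates; so the number of tuples
   alternating with first sign [e] in [c_k] plus its antipode keeps its parity
   as [k] grows, and it is 1 at [k = 0].  The
   labels are pulled back from the triangulation by an odd simplicial
   approximation. *)

Set Implicit Arguments.
Unset Strict Implicit.
Unset Printing Implicit Defensive.
Local Open Scope ring_scope.

(** * Chains of tuples modulo 2 *)

Notation "\parity_ ( i <- r ) F" := (\big[addb/false]_(i <- r) F)
  (at level 36, F at level 36, i, r at level 50).

Lemma parity_cat_map (T : Type) (h : T -> T) (f : T -> bool) s :
  \parity_(t <- s ++ map h s) f t = \parity_(t <- s) (f t (+) f (h t)).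
Proof. by rewrite big_cat big_map big_split. Qed.

Fixpoint faces (T : Type) (s : seq T) : seq (seq T) :=
  if s is x :: s' then s' :: [seq x :: t | t <- faces s'] else [::].

Lemma faces_map (T U : Type) (h : T -> U) s :
  faces (map h s) = map (map h) (faces s).
Proof.
by elim: s => //= x s ->; congr cons; rewrite -!map_comp.
Qed.

Lemma size_faces (T : eqType) (s t : seq T) :
  t \in faces s -> size s = (size t).+1.
Proof.
elim: s t => //= x s IHs t; rewrite inE => /predU1P[-> //|/mapP[u us ->]].
by rewrite (IHs _ us).
Qed.

Lemma faces_subseq (T : eqType) (s t : seq T) : t \in faces s -> subseq t s.
Proof.
elim: s t => //= x s IHs t; rewrite inE => /predU1P[->|/mapP[u us ->]].
  exact: subseq_cons.
by rewrite /= eqxx IHs.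
Qed.

Lemma parity_faces_cons (T : Type) (f : seq T -> bool) x s :
  \parity_(t <- faces (x :: s)) f t =
  f s (+) \parity_(t <- faces s) f (x :: t).
Proof. by rewrite /= big_cons big_map. Qed.

(** The boundary of a boundary vanishes mod 2: the tuples that lose the head and a further entry
    arise in both orders of deletion and cancel. *)
Lemma parity_faces_faces (T : Type) (f : seq T -> bool) s :
  \parity_(t <- faces s) \parity_(u <- faces t) f u = false.
Proof.
elim: s f => [|x s IHs] f; first by rewrite big_nil.
rewrite parity_faces_cons.
under [X in _ (+) X]eq_bigr => t _ do rewrite parity_faces_cons.
by rewrite big_split /= IHs addbF addbb.
Qed.

Lemma parity_faces_perm (T : eqType) (f : seq T -> bool) s1 s2 :
  (forall t1 t2, perm_eq t1 t2 -> f t1 = f t2) -> perm_eq s1 s2 ->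
  \parity_(t <- faces s1) f t = \parity_(t <- faces s2) f t.
Proof.
move=> fP s12.
(* Up to permutation, deleting a position amounts to deleting the value it carries, so faces can be
   indexed by entries with multiplicity. *)
have E (g : seq T -> bool) s : (forall t1 t2, perm_eq t1 t2 -> g t1 = g t2) ->
    \parity_(t <- faces s) g t = \parity_(x <- s) g (rem x s).
  elim: s g => [|x s IHs] g gP; first by rewrite !big_nil.
  rewrite parity_faces_cons IHs => [|t1 t2 t12]; last first.
    by apply: gP; rewrite perm_cons.
  rewrite big_cons /= eqxx; congr addb.
  apply: eq_big_seq => y ys /=; case: (eqVneq x y) => [->|//].
  by apply: gP; rewrite perm_sym perm_to_rem.
rewrite !E // (perm_big _ s12); apply: eq_bigr => x _.
apply: fP; apply/seq.permP => p.
by rewrite !count_rem (perm_mem s12) (seq.permP s12).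
Qed.

(* The parity of [f] over a list is the pairing of a cochain mod 2 with a
   chain; simplices are tuples of points, the empty tuple included
   (augmentation), and [a] is the antipodal map. *)
Definition hemispheres (T : Type) (a : T -> T) (c : nat -> seq (seq T)) :=
  [/\ exists x, c 0%N = [:: [:: x]],
      forall k, all (fun t => size t == k.+1) (c k) &
      forall k f, \parity_(t <- c k.+1) \parity_(u <- faces t) f u =
                  \parity_(t <- c k) (f t (+) f (map a t))].

(** Models a hemisphere of the octahedral [k]-sphere: the cone with apex [e k] over the equator,
    which is the previous hemisphere together with its antipode. *)
Fixpoint octahedron (T : Type) (a : T -> T) (e : nat -> T) (k : nat) :=
  if k is k'.+1 then
    [seq e k :: t | t <- octahedron a e k' ++ map (map a) (octahedron a e k')]
  else [:: [:: e 0%N]].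

(** The boundary of a cone is its base plus the cone over the boundary of the base. Here the base is
    a cycle, so the second part vanishes. *)
Lemma hemispheres_octahedron (T : Type) (a : T -> T) (e : nat -> T) :
  involutive a -> hemispheres a (octahedron a e).
Proof.
move=> aK; have aaK : cancel (map a) (map a) by exact: mapK.
pose c := octahedron a e.
(* The boundary of [c k.+1] is invariant under the antipode, so it cancels against its image. *)
have closed k f : (forall f, \parity_(t <- c k.+1) \parity_(u <- faces t) f u =
      \parity_(t <- c k) (f t (+) f (map a t))) ->
    \parity_(t <- c k.+1) \parity_(u <- faces t) (f u (+) f (map a u)) = false.
  move=> ->; rewrite big1 // => t _.
  by rewrite aaK; case: (f t); case: (f (map a t)).
have bnd k f : \parity_(t <- c k.+1) \parity_(u <- faces t) f u =
      \parity_(t <- c k) (f t (+) f (map a t)).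
  elim: k f => [|k IHk] f.
    rewrite /c /= !big_cons !big_nil /= !addbF.
    by rewrite addbACA addbb addbF.
  have -> : c k.+2 = [seq e k.+2 :: t | t <- c k.+1 ++ map (map a) (c k.+1)] by [].
  rewrite big_map parity_cat_map.
  under eq_bigr => t _ do rewrite !parity_faces_cons addbACA.
  rewrite big_split /= [X in _ (+) X = _](_ : _ = false) ?addbF //.
  rewrite -[RHS](closed k (fun u => f (e k.+2 :: u))) //.
  by apply: eq_bigr => t _; rewrite faces_map big_map -big_split.
split=> //; first by exists (e 0%N).
elim=> //= k IHk; rewrite all_map all_cat all_map.
by apply/andP; split; apply: sub_all IHk => t /= /eqP ts;
  rewrite ?size_map ts.
Qed.

(** Barycentric subdivision: each flag of faces of [t] is listed by its barycenters, largest face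
    first. The fuel [k] is meant to be [size t], so that recursion stops at the empty tuple. *)
Fixpoint subdivide (T : Type) (b : seq T -> T) (k : nat) (t : seq T) :=
  if k is k'.+1 then
    flatten [seq [seq b t :: u | u <- subdivide b k' s] | s <- faces t]
  else [:: t].

Lemma parity_subdivideS (T : Type) (b : seq T -> T) k t (f : seq T -> bool) :
  \parity_(s <- subdivide b k.+1 t) f s =
  \parity_(s <- faces t) \parity_(u <- subdivide b k s) f (b t :: u).
Proof.
rewrite /= big_flatten big_map; apply: eq_bigr => s _.
by rewrite big_map.
Qed.

(** Subdivision is a chain map. Dropping the apex [b t] leaves the subdivided boundary; the
    remaining faces form a cone over the boundary of that boundary, which is zero. *)
Lemma subdivide_faces (T : eqType) (b : seq T -> T) k t (f : seq T -> bool) :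
  size t = k.+1 ->
  \parity_(s <- subdivide b k.+1 t) \parity_(u <- faces s) f u =
  \parity_(s <- faces t) \parity_(u <- subdivide b k s) f u.
Proof.
elim: k t f => [|k IHk] t f tk; rewrite parity_subdivideS.
  case: t tk => [|x [|]] //= _.
  by rewrite /= !big_cons !big_nil /= ?addbF.
under eq_bigr => s _.
  under eq_bigr => u _ do rewrite parity_faces_cons.
  rewrite big_split /=; over.
rewrite big_split /= [X in _ (+) X = _](_ : _ = false) ?addbF //.
rewrite -[RHS](parity_faces_faces
  (fun w => \parity_(u <- subdivide b k w) f (b t :: u)) t).
apply: eq_big_seq => s st; apply: (IHk s (fun u => f (b t :: u))).
by have := size_faces st; rewrite tk => -[].
Qed.

Lemma subdivide_map (T : Type) (a : T -> T) (b : seq T -> T) k t :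
  (forall s, b (map a s) = a (b s)) ->
  subdivide b k (map a t) = map (map a) (subdivide b k t).
Proof.
move=> ab; elim: k t => //= k IHk t.
rewrite map_flatten faces_map -!map_comp; congr flatten.
apply: eq_map => s /=; rewrite IHk -!map_comp; apply: eq_map => u /=.
by rewrite ab.
Qed.

Lemma size_subdivide (T : eqType) (b : seq T -> T) k t s :
  size t = k -> s \in subdivide b k t -> size s = k.
Proof.
elim: k t s => [|k IHk] t s tk /=; first by rewrite inE => /eqP->.
move=> /flatten_mapP[u ut /mapP[w wu ->]] /=; rewrite (IHk u) //.
by have := size_faces ut; rewrite tk => -[].
Qed.

(** Subdivision commutes with both the boundary and the antipode. The fuel is [k.+1] because tuples
    of [c k] have [k.+1] points. *)
Lemma hemispheres_subdivide (T : eqType) (a : T -> T) (b : seq T -> T) c :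
  (forall s, b (map a s) = a (b s)) -> hemispheres a c ->
  hemispheres a (fun k => flatten [seq subdivide b k.+1 t | t <- c k]).
Proof.
move=> ab [[x c0] cs cb]; split=> [|k|k f].
- by exists (b [:: x]); rewrite c0.
- apply/allP => s /flatten_mapP[t tc ts].
  by rewrite (size_subdivide _ ts) //; apply/eqP/(allP (cs k)).
- rewrite !big_flatten !big_map.
  transitivity (\parity_(t <- c k.+1) \parity_(s <- faces t)
      \parity_(u <- subdivide b k.+1 s) f u).
    apply: eq_big_seq => t tc; apply: subdivide_faces.
    exact/eqP/(allP (cs _)).
  rewrite cb; apply: eq_bigr => t _.
  by rewrite subdivide_map // big_map -big_split.
Qed.

(** * Alternating labels and the parity argument *)

Fixpoint alt (e : bool) (s : seq bool) :=
  if s is x :: s' then (x == e) && alt (~~ e) s' else true.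

(** In an alternating word only the deletion of the first or the last sign keeps alternation, and
    exactly one face then starts with [e]. A non-alternating word has an alternating face only if it
    has a single pair of equal neighbors; deleting either neighbor gives the same face, counted
    twice. *)
Lemma parity_alt_faces e s : s != [::] ->
  \parity_(t <- faces s) alt e t = alt e s (+) alt (~~ e) s.
Proof.
elim: s e => // x [|y s] IHs e _.
  by rewrite /= !big_cons big_nil /=; case: x e => -[].
rewrite parity_faces_cons.
have -> : \parity_(t <- faces (y :: s)) alt e (x :: t) =
    (x == e) && (alt (~~ e) (y :: s) (+) alt e (y :: s)).
  rewrite -[in alt e (y :: s)](negbK e) -IHs //=.
  by case: (x == e) => //=; rewrite big1.
have altE e' : alt e' [:: x, y & s] = (x == e') && alt (~~ e') (y :: s) by [].
rewrite !altE negbK; move: (alt e (y :: s)) (alt (~~ e) (y :: s)) => A B.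
by case: x e {altE} A B => -[] [] [].
Qed.

(* Ties in absolute value are broken by sign, so that sorting is canonical. *)
Definition absle : rel int :=
  relpre (fun z : int => ((absz z).*2 + (0 < z)%R)%N) leq.

Lemma absle_total : total absle.
Proof. by move=> x y; apply: leq_total. Qed.

Lemma absle_trans : transitive absle.
Proof. by move=> y x z; apply: leq_trans. Qed.

Lemma absle_anti : antisymmetric absle.
Proof.
move=> x y; rewrite /absle /=; lia.
Qed.

Definition alternates (e : bool) (l : seq int) :=
  alt e [seq 0 < z | z <- sort absle l].

Lemma alternates_perm e l1 l2 :
  perm_eq l1 l2 -> alternates e l1 = alternates e l2.
Proof.
move=> /(perm_sortP absle_total absle_trans absle_anti).
by rewrite /alternates => ->.
Qed.

Lemma parity_alternates_faces e l : l != [::] ->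
  \parity_(t <- faces l) alternates e t =
  alternates e l (+) alternates (~~ e) l.
Proof.
move=> l0; rewrite (@parity_faces_perm _ _ _ (sort absle l)); first last.
- by rewrite perm_sym perm_sort.
- exact: alternates_perm.
rewrite -parity_alt_faces; last first.
  by rewrite -size_eq0 size_map size_sort size_eq0.
rewrite faces_map big_map; apply: eq_big_seq => t ts.
rewrite /alternates sorted_sort //; first exact: absle_trans.
apply: (subseq_sorted absle_trans (faces_subseq ts)).
exact: (sort_sorted absle_total).
Qed.

(** The hypothesis excludes opposite entries and, at [x = y], zeros. Hence ties in absolute value
    occur only between equal entries, and negation preserves the order [absle] on [l]. *)
Lemma alternatesN e l : (forall x y, x \in l -> y \in l -> x + y != 0) ->
  alternates e (map -%R l) = alternates (~~ e) l.
Proof.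
move=> lN; rewrite /alternates.
have -> : sort absle (map -%R l) = map -%R (sort absle l).
  apply: (sorted_eq absle_trans absle_anti).
  - exact: (sort_sorted absle_total).
  - rewrite sorted_map.
    have ls : all (fun x => x \in l) (sort absle l).
      by apply/allP => x; rewrite mem_sort.
    rewrite (@eq_in_sorted _ (mem l) _ absle) //; last first.
      move=> x y xl yl; rewrite /absle /=.
      by have := lN _ _ xl yl; have := lN _ _ xl xl; have := lN _ _ yl yl; lia.
    exact: (sort_sorted absle_total).
  - by rewrite perm_sort perm_sym perm_map // perm_sort.
have : all (fun x : int => x != 0) (sort absle l).
  by apply/allP => x; rewrite mem_sort => xl; have := lN _ _ xl xl; lia.
elim: (sort absle l) e => //= x s IHs e /andP[x0 s0]; rewrite IHs //.
congr andb; case: e; lia.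
Qed.

Lemma fan_hemispheres (T : eqType) (a : T -> T) c (lab : T -> int) n e :
  involutive a -> hemispheres a c ->
  (forall k t x, (k < n)%N -> t \in c k -> x \in t -> lab (a x) = - lab x) ->
  (forall k t x y, (k < n)%N -> t \in c k -> x \in t -> y \in t ->
     lab x + lab y != 0) ->
  (0 < n)%N ->
  exists2 t, t \in c n.-1 ++ map (map a) (c n.-1) & alternates e (map lab t).
Proof.
move=> aK [[x0 c0] cs cb] labN labD n0.
pose A t := alternates e (map lab t).
have Aa k t : (k < n)%N -> t \in c k ->
    A (map a t) = alternates (~~ e) (map lab t).
  move=> kn tc; rewrite /A -alternatesN.
    rewrite -!map_comp; congr alternates.
    by apply/eq_in_map => x xt; apply: (labN k t).
  by move=> _ _ /mapP[x xt ->] /mapP[y yt ->]; apply: (labD k t).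
(* For [k = 0] the single point alternates with exactly one of the two signs. For the step, [cb]
   turns the parity into a count of alternating faces in [c k.+1]. *)
have odd k : (k < n)%N -> \parity_(t <- c k) (A t (+) A (map a t)).
  elim: k => [|k IHk] kn.
    have x0c : [:: x0] \in c 0%N by rewrite c0 mem_head.
    rewrite c0 big_cons big_nil (Aa 0%N) // /A /alternates /=.
    by case: (e); case: (0 < _).
  have := IHk (ltnW kn); rewrite -cb => {IHk}.
  congr is_true; apply: eq_big_seq => t tc; rewrite (Aa k.+1) //.
  rewrite -parity_alternates_faces ?faces_map ?big_map //.
  by have /eqP := allP (cs k.+1) _ tc; case: (t).
have n1 : (n.-1 < n)%N by rewrite ltn_predL.
apply: contraTP (odd _ n1) => noA; apply/negP.
rewrite big_seq big1 // => t tc.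
have nA s : s \in c n.-1 ++ map (map a) (c n.-1) -> A s = false.
  by move=> sc; apply/negP => As; apply: noA; exists s.
by rewrite !nA // mem_cat ?tc // map_f ?orbT.
Qed.

Lemma alt_nth e s i : alt e s -> (i < size s)%N -> nth e s i = odd i (+) e.
Proof.
elim: s e i => // x s IHs e [|i] /= /andP[/eqP xe sa] // si.
rewrite (set_nth_default (~~ e)) // IHs //.
by case: (odd i); case: (e).
Qed.

(** Neighbors in the sorted list have labels of opposite signs that do not sum to zero, so their
    absolute values differ and the order is strict. *)
Lemma alternates_sorted (T : eqType) (lab : T -> int) (vs : seq T) :
  (forall x y, x \in vs -> y \in vs -> lab x + lab y != 0) ->
  alternates false (map lab vs) ->
  exists s, [/\ perm_eq s vs, sorted (relpre (absz \o lab) ltn) s &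
    forall x0 i, (i < size s)%N -> 0 < (-1) ^+ i.+1 * lab (nth x0 s i)].
Proof.
rewrite /alternates sort_map; set s := sort _ _ => vsD sA.
have mem_s x : (x \in s) = (x \in vs) by rewrite mem_sort.
have sgn x0 i : (i < size s)%N -> 0 < (-1) ^+ i.+1 * lab (nth x0 s i).
  move=> si; have := alt_nth sA (i := i).
  rewrite !size_map => /(_ si).
  rewrite (nth_map (lab x0)) ?size_map // (nth_map x0) // addbF => pos.
  have xs := mem_nth x0 si; rewrite mem_s in xs.
  have := vsD _ _ xs xs; rewrite -signr_odd /= -pos.
  by case: (ltP 0 (lab (nth x0 s i))) => /= ?; rewrite ?expr0 ?expr1; lia.
exists s; split=> //; first by rewrite perm_sort.
case: s mem_s sgn {sA} (sort_sorted (T := T) (leT := relpre lab absle)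
  (fun x y => absle_total (lab x) (lab y)) vs : sorted _ s) => // x0 s0.
move: (x0 :: s0) => s mem_s sgn /(sortedP x0) ss; apply/(sortedP x0) => i si.
have := ss i si; have := sgn x0 i (ltnW si); have := sgn x0 i.+1 si.
have := vsD _ _ (etrans (esym (mem_s _)) (mem_nth x0 (ltnW si)))
  (etrans (esym (mem_s _)) (mem_nth x0 si)).
rewrite /absle /= !exprS; move: (nth x0 s i) (nth x0 s i.+1) => x y.
by rewrite -signr_odd; case: (odd i); rewrite ?expr0 ?expr1; lia.
Qed.

(** * Fine antipodal chains in Euclidean space *)

Lemma rV_coord_le (R : realDomainType) n (x : 'rV[R]_n) j :
  `|x ord0 j| <= `|x|.
Proof.
rewrite [leRHS]mx_normrE.
exact: (le_bigmax _ (fun i : 'I_1 * 'I_n => `|x i.1 i.2|) (ord0, j)).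
Qed.

Lemma rV_norm_le (R : realDomainType) n (x : 'rV[R]_n) d :
  0 <= d -> (forall j, `|x ord0 j| <= d) -> `|x| <= d.
Proof.
move=> d0 xd; rewrite [leLHS]mx_normrE; apply/bigmax_leP; split=> // -[i j] _ /=.
by rewrite (ord1 i).
Qed.

Definition barycenter (R : fieldType) (V : lmodType R) (t : seq V) : V :=
  (size t)%:R^-1 *: \sum_(x <- t) x.

Lemma barycenterN (R : fieldType) (V : lmodType R) (t : seq V) :
  barycenter (map -%R t) = - barycenter t.
Proof. by rewrite /barycenter size_map big_map sumrN scalerN. Qed.

Lemma norm_barycenterB (R : realType) (V : normedModType R) (t : seq V) y :
  t != [::] ->
  `|barycenter t - y| <= (size t)%:R^-1 * \sum_(x <- t) `|x - y|.
Proof.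
move=> t0; have st : (size t)%:R != 0 :> R by rewrite pnatr_eq0 size_eq0.
have -> : barycenter t - y = (size t)%:R^-1 *: \sum_(x <- t) (x - y).
  rewrite sumrB big_const_seq count_predT iter_addr_0 scalerBr.
  by rewrite -[y *+ _]scaler_nat scalerA mulVf // scale1r.
rewrite normrZ ger0_norm ?invr_ge0 //.
by rewrite ler_wpM2l ?invr_ge0 // ler_norm_sum.
Qed.

Lemma norm_barycenterB_le (R : realType) (V : normedModType R) (t : seq V) y d :
  t != [::] -> (forall x, x \in t -> `|x - y| <= d) -> `|barycenter t - y| <= d.
Proof.
move=> t0 td; apply: (le_trans (norm_barycenterB y t0)).
rewrite ler_pdivrMl ?ltr0n ?lt0n ?size_eq0 // mulr_natl.
rewrite -[d *+ _]iter_addr_0 -(count_predT t) -big_const_seq.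
by rewrite big_seq [leRHS]big_seq ler_sum.
Qed.

(** The term of [v] in the average vanishes; this is the source of the contraction factor. *)
Lemma norm_barycenter_vertex (R : realType) (V : normedModType R) (t : seq V)
    v d :
  v \in t -> (forall x, x \in t -> `|x - v| <= d) ->
  `|barycenter t - v| <= (size t).-1%:R / (size t)%:R * d.
Proof.
move=> vt td; have t0 : t != [::] by case: (t) vt.
apply: (le_trans (norm_barycenterB v t0)).
rewrite [leRHS]mulrAC [leRHS]mulrC ler_wpM2l ?invr_ge0 //.
rewrite (perm_big _ (perm_to_rem vt)) big_cons /= subrr normr0 add0r.
rewrite -(size_rem vt) mulr_natl.
rewrite -[d *+ _]iter_addr_0 -(count_predT (rem v t)) -big_const_seq.
by rewrite big_seq [leRHS]big_seq ler_sum // => x /mem_rem/td.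
Qed.

Lemma mem_subdivide (T : eqType) (b : seq T -> T) k t s y :
  size t = k -> s \in subdivide b k t -> y \in s ->
  exists u, [/\ u != [::], {subset u <= t} & y = b u].
Proof.
elim: k t s => [|k IHk] t s tk /=.
  by rewrite inE => /eqP->; rewrite (size0nil tk).
move=> /flatten_mapP[t' t't /mapP[s' s't' ->]]; rewrite inE => /predU1P[->|ys'].
  by exists t; split=> //; rewrite -size_eq0 tk.
have t'k : size t' = k by have := size_faces t't; rewrite tk => -[].
have [u [u0 ut' ->]] := IHk _ _ t'k s't' ys'; exists u; split=> // x /ut'.
exact: (mem_subseq (faces_subseq t't)).
Qed.

(** The classical mesh estimate; by induction only distances to the apex [barycenter t] are new. The
    bound [n] on the sizes gives one factor for all dimensions. *)
Lemma subdivide_mesh (R : realType) (V : normedModType R) n k (t s : seq V) d :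
  size t = k -> (k <= n)%N -> (forall x y, x \in t -> y \in t -> `|x - y| <= d) ->
  s \in subdivide (@barycenter R V) k t ->
  forall x y, x \in s -> y \in s -> `|x - y| <= n.-1%:R / n%:R * d.
Proof.
elim: k t s => [|k IHk] t s tk kn td /=.
  by rewrite inE => /eqP-> x; rewrite (size0nil tk).
have d0 : 0 <= d.
  by case: (t) tk td => // x t' _ td; apply: le_trans (td x x _ _);
    rewrite ?mem_head.
move=> /flatten_mapP[t' t't /mapP[s' s't' ->]].
have t'k : size t' = k by have := size_faces t't; rewrite tk => -[].
have t'subt := mem_subseq (faces_subseq t't).
have far y : y \in s' -> `|barycenter t - y| <= n.-1%:R / n%:R * d.
  move=> ys'; have [u [u0 ut' ->]] := mem_subdivide t'k s't' ys'.
  (* Balls are convex, so the distance to the barycenter of [u] is bounded by the distances to the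
     vertices of [u]. *)
  rewrite distrC; apply: norm_barycenterB_le => // v /ut' /t'subt vt.
  rewrite distrC; apply: le_trans (norm_barycenter_vertex vt _) _.
    by move=> x xt; apply: td.
  rewrite ler_wpM2r // tk ler_pdivrMr ?ltr0n // mulrAC.
  rewrite ler_pdivlMr ?ltr0n //; last first.
    exact: leq_trans kn.
  by rewrite -!natrM ler_nat; case: (n) kn => //= n' ?; nia.
have near_s' : forall x y, x \in s' -> y \in s' -> `|x - y| <= n.-1%:R / n%:R * d.
  apply: (IHk t') => // [|x y /t'subt xt /t'subt yt]; first exact: ltnW.
  exact: td.
move=> x y; rewrite !inE => /predU1P[->|xs'] /predU1P[->|ys'].
- by rewrite subrr normr0 mulr_ge0 // divr_ge0.
- exact: far.
- by rewrite distrC far.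
- exact: near_s'.
Qed.

(* A hyperplane missing the origin by at least [1/n] keeps the refined
   simplices away from [0], so that they can be projected to the sphere. *)
Definition on_octahedron (R : realType) n (t : seq 'rV[R]_n) :=
  exists2 w : 'I_n -> R, (forall j, `|w j| <= 1) &
    forall x, x \in t -> `|x| <= 1 /\ \sum_j w j * x ord0 j = 1.

(** The norm on rows is the sup norm, so a functional with coefficients at most 1 in absolute value
    is bounded by [n] times the norm. *)
Lemma on_octahedron_norm (R : realType) n (t : seq 'rV[R]_n) x :
  on_octahedron t -> x \in t -> n%:R^-1 <= `|x| <= 1.
Proof.
move=> [w w1 tw] /tw[x1 wx]; rewrite x1 andbT.
case: n => [|n] in t w x w1 tw x1 wx *; first by rewrite invr0.
rewrite -div1r ler_pdivrMr ?ltr0n // -[leLHS]wx.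
apply: (le_trans (ler_norm _)); apply: (le_trans (ler_norm_sum _ _ _)).
rewrite mulr_natr -[X in _ *+ X]card_ord -sumr_const; apply: ler_sum => j _.
rewrite normrM -[leRHS]mul1r ler_pM //.
exact: rV_coord_le.
Qed.

Lemma on_octahedron_subdivide (R : realType) n k (t s : seq 'rV[R]_n) :
  size t = k -> on_octahedron t ->
  s \in subdivide (@barycenter _ _) k t -> on_octahedron s.
Proof.
move=> tk [w w1 tw] st; exists w => // x xs.
have [u [u0 ut ->]] := mem_subdivide tk st xs; split.
  rewrite -[barycenter u]subr0; apply: norm_barycenterB_le => // y /ut /tw[].
  by rewrite subr0.
rewrite /barycenter.
under eq_bigr => j _ do rewrite mxE summxE mulrCA mulr_sumr.
rewrite -mulr_sumr exchange_big /=.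
rewrite big_seq (eq_bigr (fun _ => 1)) => [|y /ut /tw[_ ->] //].
by rewrite -big_seq big_const_seq count_predT iter_addr_0 mulVf //
  pnatr_eq0 size_eq0.
Qed.

Lemma on_octahedron_octahedron (R : realType) n k t :
  (k < n)%N ->
  t \in octahedron -%R (fun i => \row_(j < n) (i == j :> nat)%:R : 'rV[R]_n) k ->
  on_octahedron t.
Proof.
move=> kn tc.
(* The induction also records that coordinates beyond [k] vanish, so [w] can be reset to 1 at the
   coordinate of the next apex without affecting the earlier points. *)
suff [w [w1 tw _]] : exists w : 'I_n -> R, [/\ (forall j, `|w j| <= 1),
    forall x, x \in t -> `|x| <= 1 /\ \sum_j w j * x ord0 j = 1 &
    forall x (j : 'I_n), x \in t -> (k < j)%N -> x ord0 j = 0].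
  by exists w.
pose e i := \row_(j < n) (i == j :> nat)%:R : 'rV[R]_n.
have e1 i : `|e i| <= 1.
  apply: rV_norm_le => // j; rewrite mxE.
  by case: eqP => _; rewrite ?normr1 ?normr0.
have we i (w : 'I_n -> R) (lin : (i < n)%N) :
    \sum_j w j * e i ord0 j = w (Ordinal lin).
  rewrite (bigD1 (Ordinal lin)) //= mxE eqxx mulr1 big1 ?addr0 // => j ji.
  rewrite mxE [i == j](_ : _ = false) ?mulr0 //.
  by apply: contraNF ji => /eqP ij; apply/eqP/val_inj.
have {}tc : t \in octahedron -%R e k := tc.
elim: k t kn tc => [|k IHk] t kn.
  rewrite inE => /eqP->; exists (fun=> 1); split=> [j|x|x j].
  - by rewrite normr1.
  - by rewrite inE => /eqP->; rewrite (we _ _ kn); split.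
  - by rewrite inE => /eqP-> j0; rewrite mxE ltn_eqF.
move=> /mapP[s sc ->].
have {sc} [w [w1 sw s0]] : exists w : 'I_n -> R, [/\ (forall j, `|w j| <= 1),
    forall x, x \in s -> `|x| <= 1 /\ \sum_j w j * x ord0 j = 1 &
    forall x (j : 'I_n), x \in s -> (k < j)%N -> x ord0 j = 0].
  move: sc; rewrite mem_cat => /orP[|/mapP[s' s'c ->]]; first exact/IHk/ltnW.
  have [w [w1 sw s0]] := IHk s' (ltnW kn) s'c.
  exists (fun j => - w j); split=> [j|x|x j].
  - by rewrite normrN.
  - move=> /mapP[y /sw[y1 wy] ->]; rewrite normrN; split=> //.
    by rewrite -wy; apply: eq_bigr => j _; rewrite mxE mulrNN.
  - by move=> /mapP[y /s0 y0 ->] /y0 yj; rewrite mxE yj oppr0.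
exists (fun j : 'I_n => if j == k.+1 :> nat then 1 else w j); split=> [j|x|x j].
- by case: ifP; rewrite ?normr1.
- rewrite inE => /predU1P[->|xs]; first by rewrite (we _ _ kn) /= eqxx; split.
  have [x1 wx] := sw _ xs; split=> //; rewrite -wx; apply: eq_bigr => j _.
  by case: eqP => // jk; rewrite s0 ?mulr0 // jk.
- rewrite inE => /predU1P[->|xs] kj; first by rewrite mxE ltn_eqF.
  by rewrite s0 // ltnW.
Qed.

Lemma fine_hemispheres (R : realType) n (e : R) : (0 < n)%N -> 0 < e ->
  exists2 c : nat -> seq (seq 'rV[R]_n), hemispheres -%R c &
    forall k t, (k < n)%N -> t \in c k -> on_octahedron t /\
      forall x y, x \in t -> y \in t -> `|x - y| < e.
Proof.
move=> n0 e0; pose q : R := n.-1%:R / n%:R.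
have q1 : `|q| < 1.
  rewrite ger0_norm ?divr_ge0 // ltr_pdivrMr ?ltr0n // mul1r ltr_nat.
  by rewrite ltn_predL.
(* [r] counts rounds of subdivision; 2 bounds the initial diameters, since all points lie in the
   unit ball. *)
suff fam r : exists2 c : nat -> seq (seq 'rV[R]_n), hemispheres -%R c &
    forall k t, (k < n)%N -> t \in c k -> on_octahedron t /\
      forall x y, x \in t -> y \in t -> `|x - y| <= q ^+ r * 2.
  have [r qr] : exists r, q ^+ r * 2 < e.
    have /cvgrPdist_lt/(_ (e / 2)) := cvg_expr q1.
    rewrite divr_gt0 // => /(_ isT)[r _ /(_ r (leqnn r))] /=.
    rewrite sub0r normrN => qr; exists r.
    by rewrite -ltr_pdivlMr //; apply: le_lt_trans qr; rewrite ler_norm.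
  have [c hc cP] := fam r; exists c => // k t kn tc.
  have [? tP] := cP _ _ kn tc; split=> // x y xt yt.
  exact: le_lt_trans (tP _ _ xt yt) qr.
elim: r => [|r [c hc cP]].
  eexists; first exact: (hemispheres_octahedron
    (fun i => \row_(j < n) (i == j :> nat)%:R) (@opprK _)).
  move=> k t kn tc; have tO := on_octahedron_octahedron kn tc; split=> // x y xt yt.
  have /andP[_ x1] := on_octahedron_norm tO xt.
  have /andP[_ y1] := on_octahedron_norm tO yt.
  by rewrite (le_trans (ler_normB _ _)) // expr0 mul1r lerD.
exists (fun k => flatten [seq subdivide (@barycenter _ _) k.+1 t | t <- c k]).
  by apply: hemispheres_subdivide hc => s; apply: barycenterN.
move=> k s kn /flatten_mapP[t tc st].
have tk : size t = k.+1 by case: hc => _ + _ => /(_ k)/allP/(_ _ tc)/eqP.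
have [tO tP] := cP _ _ kn tc; split; first exact: on_octahedron_subdivide tO st.
rewrite exprS -mulrA; exact: subdivide_mesh tP st.
Qed.

(** * Radial projection and simplicial approximation *)

(** The Heine-Cantor theorem. *)
Lemma compact_unif_continuous (R : realType) (U V : normedModType R)
    (K : set U) (f : U -> V) (e : R) :
  compact K -> {within K, continuous f}%classic -> 0 < e ->
  exists2 d, 0 < d & forall x y, K x -> K y -> `|x - y| < d ->
    `|f x - f y| < e.
Proof.
move=> /compact_near_coveringP cK /subspace_continuousP cf e0.
have e20 : 0 < e / 2 by rewrite divr_gt0.
(* The near-covering form of compactness is applied with the modulus [d] as parameter, tending to 0
   from the right. *)
have := cK R (0^'+)%classic (fun d x => K x -> forall y, K y -> `|x - y| < d ->
    `|f x - f y| < e) _.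
case=> [x Kx|d /= d0 dP].
  have /cvgrPdist_lt/(_ _ e20) := cf x Kx.
  rewrite near_withinE => /nbhs_ballP[r /= r0 rP].
  have r20 : 0 < r / 2 by rewrite divr_gt0.
  exists (ball x (r / 2), [set d | d < r / 2])%classic => /=.
    by split; [exact: nbhsx_ballx|exact: nbhs_right_lt].
  move=> [x' d] /= [xx' dr] Kx' y Ky x'y.
  have xx'r : `|x - x'| < r / 2 by move: xx'; rewrite -ball_normE.
  have fx' : `|f x - f x'| < e / 2.
    by apply: rP => //; rewrite -ball_normE /=; lra.
  have fy : `|f x - f y| < e / 2.
    apply: rP => //; rewrite -ball_normE /=.
    by have := ler_distD x' x y; lra.
  by have := ler_distD (f x) (f x') (f y); rewrite (distrC (f x') (f x)); lra.
have d20 : 0 < d / 2 by rewrite divr_gt0.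
exists (d / 2) => // x y Kx Ky xy.
apply: (dP (d / 2) _ _ x) => //=; rewrite sub0r normrN ger0_norm; lra.
Qed.

(** Normalizes by the Euclidean norm, written out because the norm on rows is the sup norm. *)
Definition radial (R : realType) n (x : 'rV[R]_n) : 'rV[R]_n :=
  (Num.sqrt (\sum_i x ord0 i ^+ 2))^-1 *: x.

Lemma radialN (R : realType) n (x : 'rV[R]_n) : radial (- x) = - radial x.
Proof.
rewrite /radial scalerN; under eq_bigr => i _ do rewrite mxE sqrrN.
by [].
Qed.

Lemma sum_sqr_gt0 (R : realType) n (x : 'rV[R]_n) :
  x != 0 -> 0 < \sum_i x ord0 i ^+ 2.
Proof.
move=> x0; rewrite lt_def sumr_ge0 ?andbT => [|i _]; last exact: sqr_ge0.
apply: contra x0 => /eqP/psumr_eq0P xi; apply/eqP/rowP => i; rewrite mxE.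
by apply/eqP; rewrite -sqrf_eq0 xi // => j _; rewrite sqr_ge0.
Qed.

Lemma radial_sphere (R : realType) n (x : 'rV[R]_n) :
  x != 0 -> unit_sphere R n (radial x).
Proof.
move=> /sum_sqr_gt0 x0; rewrite /unit_sphere /radial.
under eq_bigr => i _ do rewrite mxE exprMn.
by rewrite -mulr_sumr exprVn sqr_sqrtr ?ltW // mulVf // gt_eqF.
Qed.

Lemma radial_continuous (R : realType) n (x : 'rV[R]_n) :
  x != 0 -> {for x, continuous (@radial R n)}.
Proof.
move=> x0; pose s2 (y : 'rV[R]_n) := \sum_i y ord0 i ^+ 2.
have cs2 : {for x, continuous s2}.
  apply: (@cvg_big _ _ _ _ _ _ _ (nbhs x) _
    (fun i (y : 'rV[R]_n) => y ord0 i ^+ 2)) => [|i _]; first exact: add_continuous.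
  by apply: cvgM; exact: coord_continuous.
have cs : {for x, continuous (fun y => (Num.sqrt (s2 y))^-1)}.
  apply: (@continuous_comp _ _ _ (fun y => Num.sqrt (s2 y)) GRing.inv).
    exact: (continuous_comp cs2 (@sqrt_continuous R _)).
  by apply: inv_continuous; rewrite gt_eqF // sqrtr_gt0 sum_sqr_gt0.
exact: (cvgZ cs cvg_id).
Qed.

(** A sup-norm shell that contains all points of the chains by [on_octahedron_norm]. *)
Definition annulus (R : realType) n : set 'rV[R]_n :=
  [set x | n%:R^-1 <= `|x| <= 1]%classic.

Lemma compact_annulus (R : realType) n : compact (@annulus R n).
Proof.
apply: bounded_closed_compact.
  exists 1; split=> // M M1 x /= /andP[_ x1]; exact: le_trans (ltW M1).
rewrite (_ : @annulus R n =
  [set x | n%:R^-1 <= `|x|] `&` [set x | `|x| <= 1])%classic.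
  apply: closedI.
  - apply: (@preimage_closed _ _ (fun x : 'rV[R]_n => `|x|)
      [set r | n%:R^-1 <= r]%classic).
      by move=> x _; apply: norm_continuous.
    exact: closed_ge.
  - apply: (@preimage_closed _ _ (fun x : 'rV[R]_n => `|x|)
      [set r | r <= 1]%classic).
      by move=> x _; apply: norm_continuous.
    exact: closed_le.
by apply/seteqP; split=> x /= => [/andP//|[? ?]]; apply/andP.
Qed.

Lemma annulus_neq0 (R : realType) n (x : 'rV[R]_n) :
  (0 < n)%N -> annulus x -> x != 0.
Proof.
move=> n0 /andP[nx _]; rewrite -normr_gt0; apply: lt_le_trans nx.
by rewrite invr_gt0 ltr0n.
Qed.

Lemma within_continuous_radial (R : realType) n (W : topologicalType)
    (g : 'rV[R]_n -> W) : (0 < n)%N ->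
  {within unit_sphere R n, continuous g}%classic ->
  {within @annulus R n, continuous (g \o @radial R n)}%classic.
Proof.
move=> n0 /subspace_continuousP cg; apply/subspace_continuousP => x Kx.
have x0 := annulus_neq0 n0 Kx.
apply: cvg_trans (cg _ (radial_sphere x0)) => A /= gA.
have {}gA : nbhs (radial x) (fun y => unit_sphere R n y -> A (g y)) := gA.
have : nbhs x (fun y => unit_sphere R n (radial y) -> A (g (radial y))).
  exact: (radial_continuous x0 gA).
apply: filterS => y yA Ky; apply: yA; apply: radial_sphere.
exact: annulus_neq0 Ky.
Qed.

(** Barycentric coordinates sum to 1, so some coordinate reaches their average. *)
Lemma realization_vertex (R : realType) (V : finType) (F : {set {set V}}) x :
  realization R V F x -> exists v, #|V|%:R^-1 <= x ord0 (enum_rank v).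
Proof.
move=> [_ [x1 _]]; apply: contrapT => /forallNP noV.
have lt_x j : x ord0 j < #|V|%:R^-1.
  by have := noV (enum_val j); rewrite enum_valK => /negP; rewrite -ltNge.
have V0 : (0 < #|V|)%N.
  rewrite lt0n; apply/eqP => V0; have := x1; rewrite big1 => [/esym/eqP|j _].
    by rewrite oner_eq0.
  by have := ltn_ord j; rewrite {2}V0.
have : \sum_j x ord0 j < \sum_(j < #|V|) #|V|%:R^-1 :> R.
  by apply: ltr_sum => //; apply/hasP; exists (Ordinal V0); rewrite ?mem_index_enum.
by rewrite x1 sumr_const card_ord -[_ *+ _]mulr_natr mulVf ?ltxx // pnatr_eq0 -lt0n.
Qed.

(** The inverse of an odd bijection is odd, once [act_pt] is known to preserve the realization. *)
Lemma cs_sphere_odd (R : realType) n (V : finType) (F : {set {set V}}) iota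
    (h : 'rV[R]_#|V| -> 'rV[R]_n) g :
  (forall s, s \in F -> iota @: s \in F) -> involutive iota ->
  (forall x, realization R V F x -> unit_sphere R n (h x) /\ g (h x) = x) ->
  (forall y, unit_sphere R n y -> realization R V F (g y) /\ h (g y) = y) ->
  (forall x, realization R V F x -> h (act_pt R V iota x) = - h x) ->
  forall y, unit_sphere R n y -> g (- y) = act_pt R V iota (g y).
Proof.
move=> iF iK gh hg hN y Sy; have [Gy hgy] := hg y Sy.
suff /gh[_ <-] : realization R V F (act_pt R V iota (g y)).
  by rewrite hN // hgy.
have [y0 [y1 [s sF sy]]] := Gy.
split=> [j|]; first by rewrite mxE.
split.
  pose r (j : 'I_#|V|) := enum_rank (iota (enum_val j)).
  have rI : injective r.
    by move=> j k /enum_rank_inj/(can_inj iK)/enum_val_inj.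
  by rewrite -[RHS]y1 [RHS](reindex_inj rI); apply: eq_bigr => j _; rewrite mxE.
exists (iota @: s); first exact: iF.
move=> j; rewrite mxE => /sy; rewrite enum_rankK => js.
by apply/imsetP; exists (iota (enum_val j)); rewrite ?iK.
Qed.

(* One of [x] and [- x] is selected by the choice operator of the type. *)
Definition positive_half (T : zmodType) (x : T) := choose (pred2 x (- x)) x == x.

(** [choose] returns the same point from the pair [x], [- x] whichever of the two it starts from,
    and the two differ. *)
Lemma positive_halfN (R : realType) n (x : 'rV[R]_n) :
  x != 0 -> positive_half (- x) = ~~ positive_half x.
Proof.
move=> x0; rewrite /positive_half opprK.
have -> : choose (pred2 (- x) x) (- x) = choose (pred2 x (- x)) x.
  rewrite (@eq_choose _ _ (pred2 x (- x))) => [|y]; last by rewrite /= orbC.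
  by apply: choose_id; rewrite /= eqxx ?orbT.
have : pred2 x (- x) (choose (pred2 x (- x)) x) by apply: chooseP; rewrite /= eqxx.
have xN : x != - x by rewrite -addr_eq0 -mulr2n -scaler_nat scaler_eq0 pnatr_eq0.
by case/pred2P => ->; rewrite eqxx ?(negPf xN) // eq_sym (negPf xN).
Qed.

(* The vertex selected at [x] has barycentric coordinate at least [1 / #|V|] in
   [g (radial x)], so it remains in the carrier of all points close to [x]. *)
Lemma simplicial_approximation (R : realType) n (V : finType) (F : {set {set V}})
    (iota : V -> V) :
  (0 < n)%N -> cs_sphere_triangulation R n V F iota ->
  exists2 d : R, 0 < d & exists sel : 'rV[R]_n -> V,
    (forall x, x != 0 -> sel (- x) = iota (sel x)) /\
    (forall t, (forall x, x \in t -> annulus x) ->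
       (forall x y, x \in t -> y \in t -> `|x - y| < d) ->
       [set v in map sel t] \in F).
Proof.
move=> n0 [Fsub [Fv [iK [iN [iF [h [g [_ [cg [gh [hg hN]]]]]]]]]]].
have gN := cs_sphere_odd iF iK gh hg hN.
pose G := g \o @radial R n.
have GR x : x != 0 -> realization R V F (G x).
  by move=> x0; case: (hg _ (radial_sphere x0)).
have [v0 _] : exists v : V, True.
  have x0 : const_mx 1 != 0 :> 'rV[R]_n.
    apply/eqP => /rowP/(_ (Ordinal n0)); rewrite !mxE => /eqP.
    by rewrite oner_eq0.
  by have [v] := realization_vertex (GR _ x0); exists v.
have e0 : 0 < #|V|%:R^-1 :> R.
  by rewrite invr_gt0 ltr0n; apply/card_gt0P; exists v0.
have /choice[sel selP] : forall x, exists v, x != 0 ->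
    #|V|%:R^-1 <= G x ord0 (enum_rank v).
  move=> x; have [->|x0] := eqVneq x 0; first by exists v0.
  by have [v xv] := realization_vertex (GR _ x0); exists v.
have GN x v : x != 0 -> G (- x) ord0 (enum_rank v) = G x ord0 (enum_rank (iota v)).
  move=> x0; rewrite /G /= radialN gN; last exact: radial_sphere.
  by rewrite mxE enum_rankK.
pose sel' x := if positive_half x then sel x else iota (sel (- x)).
have sel'P x : x != 0 -> #|V|%:R^-1 <= G x ord0 (enum_rank (sel' x)).
  move=> x0; rewrite /sel'; case: ifP => _; first exact: selP.
  by rewrite -GN // selP // oppr_eq0.
have [d d0 dP] := compact_unif_continuous (@compact_annulus R n)
  (within_continuous_radial n0 cg) e0.
exists d => //; exists sel'; split=> [x x0|t tK td].
  rewrite /sel' positive_halfN // opprK.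
  by case: (positive_half x); rewrite //= ?iK.
case: t tK td => [|x t] tK td.
  by apply: Fsub (Fv v0) _; apply/fintype.subsetP => v; rewrite inE.
have Kx := tK x (mem_head _ _).
(* The carrier of the first point contains the vertices selected at all points of the tuple. *)
have [_ [_ [s sF sx]]] := GR x (annulus_neq0 n0 Kx).
apply: Fsub sF _; apply/fintype.subsetP => v; rewrite inE => /mapP[y yt ->{v}].
have Ky := tK y yt.
have xy := dP x y Kx Ky (td _ _ (mem_head _ _) yt).
rewrite -[sel' y]enum_rankK; apply: sx.
apply/negP => /eqP Gx0.
have := sel'P y (annulus_neq0 n0 Ky); rewrite leNgt => /negP; apply.
apply: le_lt_trans (le_lt_trans (rV_coord_le _ (enum_rank (sel' y))) xy).
by rewrite !mxE -/(G x) -/(G y) Gx0 sub0r normrN ler_norm.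
Qed.

(** * Fan's lemma on the triangulation and the count of pairs *)

Lemma fan_alternating (R : realType) n (V : finType) (F : {set {set V}})
    (iota : V -> V) (lab : V -> int) :
  (0 < n)%N -> cs_sphere_triangulation R n V F iota ->
  fan_labeling V F iota lab ->
  exists s : seq V, [/\ size s = n, [set x in s] \in F,
    sorted (relpre (absz \o lab) ltn) s &
    forall x0 i, (i < n)%N -> 0 < (-1) ^+ i.+1 * lab (nth x0 s i)].
Proof.
move=> n0 cs [lab0 [labD labN]].
have Fsub := proj1 cs.
have [d d0 [sel [selN selF]]] := simplicial_approximation n0 cs.
have [c hc cP] := fine_hemispheres n0 d0.
have cK k t x : (k < n)%N -> t \in c k -> x \in t -> annulus x.
  by move=> kn tc xt; have [tO _] := cP _ _ kn tc; apply: on_octahedron_norm tO xt.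
have labD' t : [set v in map sel t] \in F ->
    forall x y, x \in t -> y \in t -> lab (sel x) + lab (sel y) != 0.
  move=> tF x y xt yt; have [->|xy] := eqVneq (sel x) (sel y).
    by have := lab0 (sel y); lia.
  apply: labD; split=> //; apply: Fsub tF _.
  by apply/fintype.subsetP => v; rewrite !inE => /orP[] /eqP->; apply: map_f.
have cF k t : (k < n)%N -> t \in c k -> [set v in map sel t] \in F.
  move=> kn tc; have [_ td] := cP _ _ kn tc; apply: selF => // x xt.
  exact: (cK _ _ _ kn tc xt).
have labN' x : x != 0 -> lab (sel (- x)) = - lab (sel x).
  by move=> x0; rewrite selN //; have := labN (sel x); lia.
have [t tc tA] : exists2 t, t \in c n.-1 ++ map (map -%R) (c n.-1) &
    alternates false (map (lab \o sel) t).
  apply: fan_hemispheres hc _ _ _ => //; first exact: opprK.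
    move=> k t x kn tc xt; apply: labN'.
    exact: (annulus_neq0 n0 (cK _ _ _ kn tc xt)).
  by move=> k t x y kn tc; apply: labD'; apply: (cF _ _ kn tc).
have n1 : (n.-1 < n)%N by rewrite ltn_predL.
have [tn tF] : size t = n /\ [set v in map sel t] \in F.
  have cn u : u \in c n.-1 -> size u = n.
    by case: hc => _ + _ => /(_ n.-1)/allP + /[dup] => /[apply] /eqP->;
      rewrite prednK.
  move: tc; rewrite mem_cat => /orP[tc|/mapP[u uc ->]].
    by split; [exact: cn|exact: (cF _ _ n1 tc)].
  have [_ ud] := cP _ _ n1 uc.
  split; first by rewrite size_map cn.
  apply: selF => [_ /mapP[x xu ->]|_ _ /mapP[x xu ->] /mapP[y yu ->]].
    by rewrite /annulus /= normrN; exact: (cK _ _ _ n1 uc xu).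
  by rewrite -opprD normrN ud.
have tD x y : x \in map sel t -> y \in map sel t -> lab x + lab y != 0.
  by move=> /mapP[x' xt ->] /mapP[y' yt ->]; apply: (labD' t).
rewrite map_comp in tA.
have [s [ss s_sorted s_pos]] := alternates_sorted tD tA.
exists s; have sn : size s = n by rewrite (perm_size ss) size_map.
split=> //; last by move=> x0 i si; apply: s_pos; rewrite sn.
rewrite (_ : [set x in s] = [set v in map sel t]) //.
by apply/setP => v; rewrite !inE (perm_mem ss).
Qed.

Lemma good_pair_perm (R : realType) (n : nat) (V : finType)
  (F : {set {set V}}) (iota : V -> V) (lam : 'I_n -> V -> int) (col : V -> 'I_n)
  (p : {perm 'I_n}) :
  (0 < n)%N ->
  cs_sphere_triangulation R n V F iota ->
  (forall i, fan_labeling V F iota (lam i)) ->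
  compatible n V F lam ->
  (forall v, col (iota v) = col v) ->
  (forall s, s \in F -> #|s| = n -> {in s &, injective col}) ->
  exists sf : {set V} * {ffun V -> option 'I_n}, good_pair n V F lam sf.1 sf.2 /\
    (forall x, x \in sf.1 -> sf.2 x = Some (p (col x))) /\
    (forall j, exists2 x, x \in sf.1 & col x = j).
Proof.
move=> n0 cs lamF lamC col_iota col_inj.
(* Compatibility handles adjacent vertices of different colors; invariance of [col] makes antipodal
   vertices use the same labeling. *)
have labF : fan_labeling V F iota (fun v => lam (p (col v)) v).
  split=> [v|]; first by have [] := lamF (p (col v)).
  split=> [u v uv|v]; first exact: lamC.
  by rewrite col_iota; have [_ []] := lamF (p (col v)).
have [s [sn sF s_sorted s_pos]] := fan_alternating n0 cs labF.
(* Strictly increasing absolute values force [n] distinct vertices, so [s] is a facet and [col] is a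
   bijection on it. *)
have s_uniq : uniq s.
  apply: sorted_uniq s_sorted => [y x z|x] /=; [exact: ltn_trans|exact: ltnn].
have cards : #|[set x in s]| = n by rewrite cardsE (card_uniqP s_uniq).
have s_inj := col_inj _ sF cards.
have col_onto j : exists2 x, x \in s & col x = j.
  have : j \in col @: [set x in s].
    suff -> : col @: [set x in s] = [set: 'I_n]%SET by rewrite inE.
    by apply/eqP; rewrite eqEcard finset.subsetT cardsT card_ord
      card_in_imset // cards leqnn.
  by move=> /imsetP[x]; rewrite inE => xs ->; exists x.
pose f := [ffun x => if x \in s then Some (p (col x)) else None].
exists ([set x in s], f); split; last split=> [x|j] /=; first last.
- by have [x xs <-] := col_onto j; exists x; rewrite ?inE.
- by rewrite inE ffunE => ->.
have [x0 _] : exists x : V, True.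
  by have [x _ _] := col_onto (Ordinal n0); exists x.
have sx (k : 'I_n) : nth x0 s k \in s by rewrite mem_nth // sn.
rewrite /good_pair sF /=; apply/andP; split; first apply/andP;
  first split; first apply/andP.
- split; last first.
    apply/forall_inP => x; rewrite inE => xs; apply/forall_inP => y.
    rewrite inE => ys; apply/implyP; rewrite !ffunE xs ys.
    move=> /eqP[/perm_inj/s_inj]; rewrite !inE => xy; exact/eqP/xy.
  by apply/forallP => x; rewrite inE ffunE; case: (x \in s).
- apply/forallP => j; have [x xs xj] := col_onto ((p^-1)%g j).
  by apply/exists_inP; exists x; rewrite ?inE // ffunE xs xj permKV.
apply/fintype.existsP; exists [ffun k : 'I_n => nth x0 s k].
have labE (k : 'I_n) : lab_at n V lam f ([ffun k : 'I_n => nth x0 s k] k) =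
    lam (p (col (nth x0 s k))) (nth x0 s k).
  by rewrite /lab_at !ffunE sx.
apply/andP; split; first apply/andP; first split; first apply/andP; first split.
- apply/forallP => x; rewrite inE; apply/eqP; apply/idP/fintype.existsP => [xs|[k]].
    have xk : (index x s < n)%N by rewrite -sn index_mem.
    by exists (Ordinal xk); rewrite ffunE nth_index.
  by rewrite ffunE => /eqP <-.
- apply/forallP => k; apply/forallP => k'; apply/implyP; rewrite !ffunE.
  by rewrite nth_uniq ?sn.
- apply/forallP => k; apply/implyP => _; rewrite labE.
  exact: (s_pos x0 k (ltn_ord k)).
- apply/forallP => k; apply/forallP => k'; apply/implyP => /eqP kk'.
  rewrite !labE -kk'.
  have kn : (k'.+1 < n)%N by rewrite kk'.
  have := s_pos x0 k'.+1 kn; have := s_pos x0 k' (ltnW kn).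
  (* Both signed labels are positive, hence equal to their absolute values, which increase
     strictly. *)
  have := sortedP x0 s_sorted k'; rewrite sn => /(_ kn) /=.
  move: (lam _ _) (lam _ _) => a b.
  rewrite !exprS -signr_odd; case: (odd _); rewrite ?expr0 ?expr1; lia.
Qed.

Unset Implicit Arguments.
Local Close Scope ring_scope.

Theorem theorem4p1 (R : realType) (n : nat) (V : finType)
  (F : {set {set V}}) (iota : V -> V) (lam : 'I_n -> V -> int) :
  (0 < n)%N ->
  cs_sphere_triangulation R n V F iota ->
  (forall i, fan_labeling V F iota (lam i)) ->
  compatible n V F lam ->
  balanced_quotient n V F iota ->
  (n`! <= #|[set p : {set V} * {ffun V -> option 'I_n} |
              good_pair n V F lam p.1 p.2]|)%N.
Proof.
move=> n0 cs lamF lamC [col [col_iota col_inj]].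
have /choice[sf sfP] := fun p : {perm 'I_n} =>
  good_pair_perm p n0 cs lamF lamC col_iota col_inj.
have sf_inj : injective sf.
  move=> p q pq; apply/permP => j.
  have [_ [px /(_ j)[x xs <-]]] := sfP p; have [_ [qx _]] := sfP q.
  by have := px x xs; rewrite pq qx -?pq // => -[].
rewrite -[X in (X`! <= _)%N]card_ord -[X in (X`! <= _)%N]cardsT -card_perm.
rewrite -(card_imset _ sf_inj); apply: subset_leq_card.
by apply/fintype.subsetP => _ /imsetP[p _ ->]; rewrite inE; case: (sfP p).
Qed.
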